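(* Let $\Gamma$ be a finite non-solvable group and let $\mathcal{X}=\mathcal{X}^{-1}\subset\Gamma$ be a generating set with $1_\Gamma\notin\mathcal{X}$ such that the only automorphisms of the (right-invariant) Cayley graph $G=\mathrm{Cay}(\Gamma,\mathcal{X})$ are the shifts $g\mapsto gh$ by elements $h\in\Gamma$ (so that $\mathrm{Aut}(G)=\Gamma$). Then the invariant projection of $\ell_1(E)$ onto the cycle space $Z(G)$, where $E$ is the edge set of $G$, is not unique: there exist at least two distinct linear projections of $\mathbb{R}^E$ onto $Z(G)$ that commute with every element of $\mathrm{Cyc}(G)$.
   Context: $\mathrm{Cay}(\Gamma,\mathcal{X})$ is the graph with vertex set $\Gamma$ in which $g,h$ are joined by an edge if and only if $hg^{-1}\in\mathcal{X}$. For a finite graph $G=(V,E)$ with a fixed arbitrary orientation of its edges (tail $e^-$, head $e^+$), the cycle space is $Z(G)=\{F\in\mathbb{R}^E:\ \sum_{e^+=v}F(e)=\sum_{e^-=v}F(e)\text{ for all }v\in V\}$. $\ell_1(E)$ is $\mathbb{R}^E$ with the $\ell_1$-norm. $\mathrm{Cyc}(G)$ is the group of linear isometries of $\ell_1(E)$ that map $Z(G)$ onto itself. *)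

(* Defs.v *)
From HB Require Import structures.
From mathcomp Require Import all_boot all_order all_algebra all_fingroup all_solvable.
From mathcomp Require Import reals.

Set Implicit Arguments.
Unset Strict Implicit.
Unset Printing Implicit Defensive.

Import GRing.Theory Num.Theory.
Local Open Scope ring_scope.

(* A finite simple graph on T is given by its adjacency relation r : rel T;
   symmetry and irreflexivity are not bundled (cayley X has both as soon as
   X^-1 = X and 1 \notin X). *)

Definition edge_set (T : finType) (r : rel T) : {set {set T}} :=
  [set [set x; y] | x in T, y in T & r x y].

Record edge (T : finType) (r : rel T) := Edge {
  edge_ends : {set T};
  edge_endsP : edge_ends \in edge_set r
}.

HB.instance Definition _ (T : finType) (r : rel T) :=
  [isSub for @edge_ends T r].
HB.instance Definition _ (T : finType) (r : rel T) :=
  [Finite of edge r by <:].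

Definition is_orientation (T : finType) (r : rel T) (tail head : edge r -> T) :
    Prop :=
  forall e : edge r, edge_ends e = [set tail e; head e].

Definition graph_automorphism (T : finType) (r : rel T) (s : {perm T}) : Prop :=
  forall x y : T, r (s x) (s y) = r x y.

Definition cayley (gT : finGroupType) (X : {set gT}) : rel gT :=
  fun g h => (h * g^-1)%g \in X.

(* R^E; the regular module R^o makes it a finite-dimensional vector space, so
   that 'End(edge_space R r) is the type of its linear endomorphisms. *)
Notation edge_space R r := {ffun edge r -> R^o}.

Definition l1_norm (R : realType) (T : finType) (r : rel T)
    (F : edge_space R r) : R :=
  \sum_(e : edge r) `|F e : R|.

Definition in_cycle_space (R : realType) (T : finType) (r : rel T)
    (tail head : edge r -> T) (F : edge_space R r) : Prop :=
  forall v : T,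
    \sum_(e : edge r | head e == v) F e = \sum_(e : edge r | tail e == v) F e.

(* Linear isometries are automatically bijective here, by finite dimension. *)
Definition in_Cyc (R : realType) (T : finType) (r : rel T)
    (tail head : edge r -> T) (phi : 'End(edge_space R r)) : Prop :=
  (forall F, l1_norm (phi F) = l1_norm F) /\
  (forall F, in_cycle_space tail head F <->
     exists2 F', in_cycle_space tail head F' & phi F' = F).

Definition projection_onto_cycle_space (R : realType) (T : finType) (r : rel T)
    (tail head : edge r -> T) (P : 'End(edge_space R r)) : Prop :=
  (forall F, P (P F) = P F) /\
  (forall F, in_cycle_space tail head F <-> exists F', P F' = F).

Definition invariant_projection (R : realType) (T : finType) (r : rel T)
    (tail head : edge r -> T) (P : 'End(edge_space R r)) : Prop :=
  projection_onto_cycle_space tail head P /\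
  (forall phi : 'End(edge_space R r), in_Cyc tail head phi ->
     forall F, P (phi F) = phi (P F)).

(* Main.v *)
Require Import Defs.
From HB Require Import structures.
From mathcomp Require Import all_boot all_order all_algebra all_fingroup all_solvable.
From mathcomp Require Import reals lra zify.

(* An l1-isometry of R^E is a signed permutation of the edges, hence orthogonal,
   so one that preserves Z also preserves the cut space B, the orthogonal
   complement of Z, and the orthogonal projection P onto Z is invariant.  The
   other invariant projections are the P + A with A : R^E -> Z equivariant and
   zero on Z, so it suffices to find one such A <> 0.

   The group of equivariance is as small as possible.  In a vertex-transitive
   graph the smallest among the vertex sets of least boundary are pairwise
   disjoint; in a Cayley graph the one through 1 is then a subgroup H, and a
   boundary of at most 2 vertices leaves so little room that the group is
   generated by two involutions or by two commuting elements, thus solvable.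
   So G is 3-connected.  By Whitney's argument the elements of Cyc(G) are then,
   up to a global sign, the graph automorphisms: vertex cuts are the elements of
   B of minimal support whose complement is not separated by Z, so they are
   permuted up to sign.  Therefore Cyc(G) is {1, -1} times the shifts.

   For a generator s, let A F be the projection onto Z of the sum over g of the
   divergence of F at g times the oriented edge from g to s g.  It commutes with
   the shifts and vanishes on Z; it is not zero because some cycle passes through
   the edge {1, s} and avoids the edge {v, s v}. *)

Set Implicit Arguments.
Unset Strict Implicit.
Unset Printing Implicit Defensive.

Import Order.TTheory GRing.Theory Num.Theory.

(** * Boundaries in Cayley graphs *)

Lemma set_card_le3 (T : finType) (x : T) (Y : {set T}) :
  x \in Y -> #|Y| <= 3 -> exists a b, Y = [set x; a; b].
Proof.
move=> Yx cY; have YE := setD1K Yx; have := cardsD1 x Y; rewrite Yx => cE.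
case: (set_0Vmem (Y :\ x)) => [Y0|[a aY]].
  by exists x, x; rewrite -YE Y0 setU0 !setUid.
have YE2 := setD1K aY; have := cardsD1 a (Y :\ x); rewrite aY => cE2.
case: (set_0Vmem (Y :\ x :\ a)) => [Y0|[b bY]].
  by exists a, a; rewrite -YE -YE2 Y0 setU0 -setUA setUid.
have YE3 := setD1K bY; have := cardsD1 b (Y :\ x :\ a); rewrite bY => cE3.
have /eqP Y0 : Y :\ x :\ a :\ b == set0 by rewrite -cards_eq0; lia.
by exists a, b; rewrite -YE -YE2 -YE3 Y0 setU0 setUA.
Qed.

(* [N A] is the closed neighbourhood of [A], and the argument is submodularity of
   the boundary size [#|N A| - #|A|]. *)
Lemma exists_atom (T : finType) (N : {set T} -> {set T}) (A0 : {set T}) (m : nat) :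
    (forall A : {set T}, A \subset N A) ->
    (forall A B : {set T}, N (A :|: B) = N A :|: N B) ->
    (forall A : {set T}, N (~: N A) \subset ~: A) ->
    A0 != set0 -> N A0 != setT -> #|N A0| <= #|A0| + m ->
  exists (A : {set T}) k, [/\ A != set0, N A != setT, #|N A| = k + #|A|, k <= m &
    forall B : {set T}, #|B| = #|A| -> #|N B| = #|N A| -> A :&: B != set0 -> B = A].
Proof.
move=> sN NU Nsym A0_neq0 NA0 cA0.
pose ok (A : {set T}) := (A != set0) && (N A != setT).
pose bd (A : {set T}) := #|N A| - #|A|.
have bdE A : #|N A| = bd A + #|A| by rewrite subnK // subset_leq_card.
have NS (A B : {set T}) : A \subset B -> N A \subset N B.
  by move=> /setUidPr <-; rewrite NU subsetUl.
have c0 (A : {set T}) : A != set0 -> 0 < #|A| by rewrite card_gt0.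
have okA0 : ok A0 by rewrite /ok A0_neq0.
case: (arg_minnP bd okA0) => B0 okB0 minB0; set k := bd B0 in minB0.
have km : k <= m by have := minB0 A0 okA0; have := bdE A0; lia.
have okB0' : ok B0 && (bd B0 == k) by rewrite okB0 eqxx.
pose size (B : {set T}) := #|B|.
case: (@arg_minnP _ B0 (fun B => ok B && (bd B == k)) size okB0').
move=> {A0 A0_neq0 NA0 cA0 okA0 okB0 okB0'}A /andP[okA /eqP bdA] minA'.
have minA B : ok B -> bd B = k -> #|A| <= #|B|.
  by move=> okB bdB; apply: minA'; rewrite okB bdB eqxx.
have [A0 NA] := andP okA.
have cNA : #|N A| = k + #|A| by rewrite bdE bdA.
(* The complement of [N A] has boundary at most [k], hence exactly [k], so it is at least as large
   as [A]. *)
have card2A : 2 * #|A| + k <= #|T|.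
  have sAc := subset_leq_card (Nsym A).
  have A1 := c0 _ A0; have eA := cardsC A; have eNA := cardsC (N A).
  have okAc : ok (~: N A).
    apply/andP; split; first by rewrite -subset0 -setCS setCK setC0 subTset.
    by apply/eqP => NT; move: sAc; rewrite NT cardsT; lia.
  have e1 := minB0 _ okAc; have e2 := bdE (~: N A).
  have bdk : bd (~: N A) = k by lia.
  by have := minA _ okAc bdk; lia.
exists A, k; split=> // B cB cNB I0.
have sI : N (A :&: B) \subset N A :&: N B.
  by rewrite subsetI !NS ?subsetIl ?subsetIr.
have okI : ok (A :&: B).
  rewrite /ok I0 -subTset; apply: contra NA => /subset_trans/(_ sI).
  by rewrite subsetI => /andP[]; rewrite subTset.
have I1 := c0 _ I0.
have e1 := minB0 _ okI; have e2 := subset_leq_card sI; have e3 := bdE (A :&: B).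
have e4 := cardsUI A B; have e5 := cardsUI (N A) (N B).
have e6 := bdE (A :|: B); rewrite NU in e6.
(* [N A :&: N B] contains [N (A :&: B)], of size at least [k + 1], so by [card2A] the union of [N A]
   and [N B] is not everything. *)
have okU : ok (A :|: B).
  rewrite /ok setU_eq0 negb_and A0 NU /=; apply/eqP => NT.
  by move: e5; rewrite NT cardsT; lia.
have e7 := minB0 _ okU.
(* The boundaries of [A :&: B] and [A :|: B] add up to at most [2 * k] and each is at least [k], so
   [A :&: B] also has minimal boundary. *)
have e8 : #|A| <= #|A :&: B| by apply: minA => //; lia.
have /eqP AI : A :&: B == A by rewrite eqEcard subsetIl.
by apply/esym/eqP; rewrite eqEcard cB leqnn andbT; apply/setIidPl.
Qed.

Section Isoperimetry.
Local Open Scope group_scope.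
Variable gT : finGroupType.
Implicit Types (x y a b : gT) (A B Y : {set gT}).

Lemma solvable_gen_commute a b : commute a b -> solvable <<[set a; b]>>.
Proof.
move=> cab; apply: abelian_sol; rewrite abelian_gen.
apply/centsP => x /set2P[] -> y /set2P[] -> //.
Qed.

(** [a] inverts [a * b], so the cyclic group [<[a * b]>] is normalised by [a] and has a cyclic
    quotient. *)
Lemma solvable_gen_invol a b :
  a * a = 1 -> b * b = 1 -> solvable <<[set a; b]>>.
Proof.
move=> aa bb.
have nK : <[a]> \subset 'N(<[a * b]>).
  rewrite cycle_subG; apply/normP; rewrite -cycleJ.
  have aV : a^-1 = a by apply: (mulgI a); rewrite mulgV aa.
  have bV : b^-1 = b by apply: (mulgI b); rewrite mulgV bb.
  have -> : (a * b) ^ a = (a * b)^-1.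
    by rewrite invMg aV bV conjgE aV !mulgA aa mul1g.
  by rewrite cycleV.
have sK : <<[set a; b]>> \subset <[a * b]> <*> <[a]>.
  rewrite gen_subG; apply/subsetP => x /set2P[] ->.
    exact: (subsetP (joing_subr _ _)) (cycle_id _).
  rewrite -[b in b \in _](mulKg a) groupM ?groupV //.
    exact: (subsetP (joing_subr _ _)) (cycle_id _).
  exact: (subsetP (joing_subl _ _)) (cycle_id _).
apply: solvableS sK _.
rewrite (@series_sol _ _ <[a * b]>%G); last first.
  by rewrite /normal joing_subl join_subG normG nK.
rewrite /= norm_joinEr // quotientMidl.
by rewrite !abelian_sol ?quotient_abelian ?cycle_abelian.
Qed.

(** Write [Y] as 1, [a], [b], repetitions allowed. As [Y] is closed under inversion, either one of
    [a], [b] is 1, or they are mutually inverse, or both square to 1. *)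
Lemma solvable_gen_card3 Y : 1 \in Y -> Y^-1 = Y -> #|Y| <= 3 -> solvable <<Y>>.
Proof.
move=> Y1 Yinv cY.
have [a [b YE]] := set_card_le3 Y1 cY.
have sY : <<Y>> \subset <<[set a; b]>>.
  rewrite gen_subG YE; apply/subsetP => x; rewrite !inE => /orP[/orP[]|] /eqP-> //.
  - exact: mem_gen (set21 _ _).
  - exact: mem_gen (set22 _ _).
apply: solvableS sY _.
have inY x : x \in Y -> x^-1 \in Y by rewrite -{2}Yinv mem_invg invgK.
have := inY a; have := inY b; rewrite YE !inE !eqxx !orbT /=.
have c1 x y : x^-1 = 1 -> commute x y.
  by move=> /(canRL invgK) ->; rewrite invg1; rewrite /commute mulg1 mul1g.
have cV x y : x^-1 = y -> commute x y.
  by move=> <-; rewrite /commute mulgV mulVg.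
move=> /(_ isT)/orP[/orP[]|]/eqP bE.
- by move=> _; apply: solvable_gen_commute; apply/commute_sym/c1.
- by move=> _; apply: solvable_gen_commute; apply/commute_sym/cV.
move=> /(_ isT)/orP[/orP[]|]/eqP aE.
- by apply: solvable_gen_commute; apply: c1.
- by apply: solvable_gen_invol; rewrite -1?{2}aE -1?{2}bE mulgV.
- by apply: solvable_gen_commute; apply: cV.
Qed.

(** Right translation preserves boundary size, so the set [A] from [exists_atom] equals every right
    translate that it meets, and its translate [H] through 1 is a subgroup. [Y * H] contains a
    further left coset of [H], whence [#|H| <= k <= 2]. Either [#|Y| <= 3], or [Y] consists of 1,
    [h], [y], [y * h] with [y] and [h] commuting. *)
Lemma small_boundary_solvable Y A : 1 \in Y -> Y^-1 = Y -> <<Y>> = [set: gT] ->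
  A != set0 -> Y * A != [set: gT] -> #|Y * A| <= #|A| + 2 -> solvable [set: gT].
Proof.
move=> Y1 Yinv Ygen A0 YA cA.
have sY B : B \subset Y * B by rewrite -{1}[B]mul1g mulSg // sub1set.
have symY B : Y * ~: (Y * B) \subset ~: B.
  apply/subsetP => _ /mulsgP[y x Yy + ->].
  rewrite !inE; apply: contra => yxB; rewrite -[x](mulKg y) mem_mulg //.
  by rewrite -Yinv mem_invg invgK.
have [{A0 YA cA}A [k [A0 YA cYA k2 transA]]] :=
  exists_atom sY (mulgU Y) symY A0 YA cA.
have trans h : A :&: A :* h != set0 -> A :* h = A.
  by apply: transA; rewrite ?mulgA card_rcoset.
have /set0Pn[a Aa] := A0.
pose H := A :* a^-1.
have H1 : 1 \in H by rewrite mem_rcoset invgK mul1g.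
have HA : A = H :* a by rewrite /H -rcosetM mulVg mulg1.
have Htrans x : x \in H -> H :* x = H.
  move=> Hx.
  have E : A :* (a^-1 * x * a) = A.
    apply: trans; apply/set0Pn; exists (x * a); rewrite inE; apply/andP; split.
      by move: Hx; rewrite mem_rcoset invgK.
    by rewrite mem_rcoset !invMg invgK !mulgA mulgK mulgV mul1g.
  by rewrite /H -{2}E -!rcosetM mulgK.
have gH : group_set H.
  apply/group_setP; split=> // x y Hx Hy.
  by rewrite -(Htrans y Hy) mem_rcoset mulgK.
have cH : #|H| = #|A| := card_rcoset A a^-1.
have cYH : #|Y * H| = k + #|H| by rewrite mulgA card_rcoset cH.
have YH : Y * H != [set: gT].
  apply: contra YA => /eqP YT; rewrite HA mulgA YT -subTset.
  by apply/subsetP => x _; rewrite mem_rcoset inE.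
pose HG := Group gH.
rewrite -[H]/(HG : {set gT}) in H1 cYH YH.
have [y Yy Hy] : exists2 y, y \in Y & y \notin HG.
  apply/subsetPn; apply: contra YH => sYH.
  rewrite -subTset -(mul1g [set: gT]) mulgSS ?sub1set //.
  by rewrite -Ygen gen_subG.
have IH : y *: HG :&: HG = set0.
  apply/setP => z; rewrite !inE mem_lcoset; apply/negP => /andP[yz Hz].
  by case/negP: Hy; rewrite -groupV -(groupMr _ Hz).
have sU : y *: HG :|: HG \subset Y * HG.
  by rewrite subUset sY mulSg ?sub1set.
have e1 : #|y *: HG| = #|HG| := card_lcoset HG y.
have e2 : #|y *: HG :|: HG| = #|y *: HG| + #|HG|.
  by rewrite -cardsUI IH cards0 addn0.
have e3 : #|y *: HG :|: HG| <= #|Y * HG| := subset_leq_card sU.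
have [cY|cY] := leqP #|Y| 3; first by rewrite -Ygen; apply: solvable_gen_card3.
have sYY : Y \subset Y * HG by rewrite -{1}[Y]mulg1 mulgS // sub1set.
have e4 : #|Y| <= #|Y * HG| := subset_leq_card sYY.
have hk : #|HG| <= k by move: e3; rewrite e2 e1 cYH leq_add2r.
have arith (h : nat) : h <= k -> 3 < k + h -> h = 2 /\ k = 2.
  by clear - k2; lia.
have [|cH2 kE] := arith _ hk; first by rewrite -cYH (leq_trans cY).
have eU : Y * HG = y *: HG :|: HG.
  by apply/esym/eqP; rewrite eqEcard sU cYH e2 e1 kE cH2.
have [h HGE h1] : exists2 h, (HG : {set gT}) = [set 1; h] & h != 1.
  have /cards1P[h hE] : #|HG :\ 1| == 1%N.
    by move: cH2; rewrite (cardsD1 1 HG) group1 => /eqP.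
  exists h; first by rewrite -hE setD1K.
  by have := set11 h; rewrite -hE !inE => /andP[].
have Hh : h \in HG by rewrite HGE set22.
have hV : h^-1 = h.
  have : h^-1 \in HG by rewrite groupV.
  by rewrite HGE !inE invg_eq1 (negPf h1) => /eqP.
have YHE z : z \in Y -> z \notin HG -> z = y \/ z = y * h.
  move=> Yz Hz; have := subsetP sYY z Yz; rewrite eU inE (negPf Hz) orbF.
  rewrite mem_lcoset HGE !inE => /orP[]/eqP e; [left|right].
    by rewrite -(mulKVg y z) e mulg1.
  by rewrite -(mulKVg y z) e.
have inV z : z \in Y -> z^-1 \in Y by rewrite -{2}Yinv mem_invg invgK.
have cyh : commute y h.
  (* [y^-1] can only be [y] or [y * h]. The second value makes [h] a power of [y]; the first makes
     [h * y], the inverse of [y * h], equal to [y * h]. *)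
  have HyV : y^-1 \notin HG by rewrite groupV.
  have [yV|yV] := YHE _ (inV _ Yy) HyV; last first.
    have -> : h = y^-1 * y^-1 by rewrite {2}yV mulKg.
    by rewrite /commute mulKVg mulgKV.
  have Yyh : y * h \in Y.
    have /eqP -> : Y == Y * HG by rewrite eqEcard sYY cYH kE cH2.
    by rewrite mem_mulg.
  have := YHE (y * h)^-1 (inV _ Yyh); rewrite groupV groupMr // => /(_ Hy).
  rewrite invMg yV hV; case=> e; last by rewrite /commute.
  by case/eqP: h1; apply: (mulIg y); rewrite mul1g.
rewrite -Ygen; apply: solvableS (solvable_gen_commute cyh).
rewrite gen_subG; apply/subsetP => z Yz.
have [Hz|Hz] := boolP (z \in HG).
  move: Hz; rewrite HGE !inE => /orP[]/eqP-> //.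
  exact: mem_gen (set22 _ _).
have yG : y \in <<[set y; h]>> by apply: mem_gen (set21 _ _).
have hG : h \in <<[set y; h]>> by apply: mem_gen (set22 _ _).
by have [->|->] := YHE z Yz Hz; rewrite ?groupM.
Qed.
End Isoperimetry.

(** * Degree and connectivity of the Cayley graph *)

Definition within (T : finType) (r : rel T) (A : {set T}) : rel T :=
  [rel x y | [&& r x y, x \in A & y \in A]].

Section Cayley.
Variables (gT : finGroupType) (X : {set gT}).
Hypotheses (nonsolvable : ~~ solvable [set: gT]) (Xinv : (X^-1)%g = X).
Hypotheses (Xgen : <<X>>%g = [set: gT]) (X1 : 1%g \notin X).
Local Open Scope group_scope.
Local Notation r := (cayley X).
Local Notation Y := (1 |: X).

Lemma cayley_sym : symmetric r.
Proof. by move=> g h; rewrite /cayley -{1}Xinv mem_invg invMg invgK. Qed.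

Lemma cayley_irr : irreflexive r.
Proof. by move=> g; rewrite /cayley mulgV (negPf X1). Qed.

Let Y1 : 1 \in Y. Proof. exact: setU11. Qed.
Let Yinv : Y^-1 = Y. Proof. by rewrite invUg invg_set1 invg1 Xinv. Qed.
Let Ygen : <<Y>> = [set: gT].
Proof. by apply/eqP; rewrite -subTset -Xgen genS ?subsetUr. Qed.

(** Adjacency is left multiplication by [X], so [Y * A] is the closed neighbourhood of [A]. *)
Lemma cayley_boundary (A : {set gT}) :
  A != set0 -> Y * A != [set: gT] -> #|A| + 2 < #|Y * A|.
Proof.
move=> A0 YA; rewrite ltnNge; apply: contra nonsolvable.
exact: small_boundary_solvable Y1 Yinv Ygen A0 YA.
Qed.

(** With fewer than four elements [Y] would generate a solvable group, so [v], [u], [u'] do not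
    exhaust [Y :* v]. *)
Lemma cayley_degree v u u' : exists w, [/\ r v w, w != u & w != u'].
Proof.
have cY : 3 < #|Y|.
  rewrite ltnNge; apply: contra nonsolvable => cY.
  by rewrite -Ygen; apply: solvable_gen_card3.
have /subsetPn[w wY] : ~~ (Y :* v \subset [set v; u; u']).
  apply: contraL cY => /subset_leq_card; rewrite card_rcoset -leqNgt.
  move=> /leq_trans; apply; rewrite setUC cardsU1 cards2.
  by case: (_ \notin _); case: (_ != _).
rewrite !inE !negb_or => /andP[/andP[wv wu] wu']; exists w; split=> //.
move: wY; rewrite mem_rcoset !inE => /orP[|//].
by rewrite -(inj_eq (mulIg v)) mulgKV mul1g (negPf wv).
Qed.

(** This is 3-connectedness; [u = v] covers the deletion of one vertex. The component [A] of [w] has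
    its boundary inside [[set u; v]], which is too small unless [Y * A] is everything. *)
Lemma cayley_connected u v w w' : w \notin [set u; v] -> w' \notin [set u; v] ->
  connect (within r (~: [set u; v])) w w'.
Proof.
move=> wN w'N.
pose A := [set a in ~: [set u; v] | connect (within r (~: [set u; v])) w a].
have wA : w \in A by rewrite inE in_setC wN connect0.
have YA : Y * A \subset A :|: [set u; v].
  apply/subsetP => _ /mulsgP[y a + aA ->].
  rewrite in_setU1 => /orP[/eqP->|Xy]; first by rewrite mul1g inE aA.
  rewrite in_setU orbC; case: (boolP (_ \in [set u; v])) => //= yaN.
  move: aA; rewrite inE => /andP[aN wa]; rewrite inE in_setC yaN /=.
  apply: connect_trans wa (connect1 _).
  by rewrite /within /= aN in_setC yaN /cayley mulgK Xy.
apply: contraT => ww'.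
have w'A : w' \notin A by rewrite inE (negPf ww') andbF.
have A0 : A != set0 by apply/set0Pn; exists w.
have YAT : Y * A != [set: gT].
  apply/eqP => YT; have := subsetP YA w'.
  by rewrite YT inE in_setU (negPf w'A) (negPf w'N) => /(_ isT).
have := cayley_boundary A0 YAT; rewrite ltnNge; case/negP.
apply: leq_trans (subset_leq_card YA) _.
rewrite cardsU (leq_trans (leq_subr _ _)) // leq_add2l cards2.
by case: (_ != _).
Qed.

End Cayley.

Local Open Scope ring_scope.

(** * Cycles and cuts *)

Lemma exists_linfun (K : fieldType) (U W : vectType K) (f : U -> W) :
  linear f -> exists g : 'Hom(U, W), forall x, g x = f x.
Proof.
move=> fL; pose m := GRing.isLinear.Build _ _ _ _ f fL.
pose L : {linear U -> W} := HB.pack f m.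
by exists (linfun L) => x; rewrite lfunE.
Qed.

Section Graph.
Variables (R : realType) (T : finType) (r : rel T).
Variables (tail head : edge r -> T).
Hypothesis orient : is_orientation tail head.
Hypotheses (rsym : symmetric r) (rirr : irreflexive r).
Local Notation E := (edge r).
Local Notation V := (edge_space R r).
Local Notation cycle := (in_cycle_space tail head).
Implicit Types (F G z : V) (e : E) (x y u v w : T) (f : T -> R) (phi : 'End(V)).

Definition dot F G : R := \sum_(e : E) (F e : R) * (G e : R).

Lemma dotC F G : dot F G = dot G F.
Proof. by apply: eq_bigr => e _; rewrite mulrC. Qed.

Lemma dotDl F G H : dot (F + G) H = dot F H + dot G H.
Proof. by rewrite -big_split; apply: eq_bigr => e _; rewrite ffunE mulrDl. Qed.

Lemma dotZl (a : R) F G : dot (a *: F) G = a * dot F G.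
Proof. by rewrite big_distrr; apply: eq_bigr => e _; rewrite ffunE /= mulrA. Qed.

Lemma dotDr F G H : dot H (F + G) = dot H F + dot H G.
Proof. by rewrite !(dotC H) dotDl. Qed.

Lemma dotZr (a : R) F G : dot F (a *: G) = a * dot F G.
Proof. by rewrite !(dotC F) dotZl. Qed.

Lemma dotNl F G : dot (- F) G = - dot F G.
Proof. by rewrite -scaleN1r dotZl mulN1r. Qed.

Lemma dotNr F G : dot F (- G) = - dot F G.
Proof. by rewrite !(dotC F) dotNl. Qed.

Lemma dot_self_eq0 F : dot F F = 0 -> F = 0.
Proof.
move/eqP; rewrite psumr_eq0 => [/allP F0|e _]; last by rewrite -expr2 sqr_ge0.
apply/ffunP => e; rewrite ffunE; apply/eqP.
by have := F0 e (mem_index_enum e); rewrite /= mulf_eq0 orbb.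
Qed.

Definition delta e : V := [ffun e' => (e' == e)%:R].

Lemma dot_delta F e : dot F (delta e) = F e.
Proof.
rewrite /dot (bigD1 e) //= ffunE eqxx mulr1 big1 ?addr0 // => e' /negPf ne.
by rewrite ffunE ne mulr0.
Qed.

(** The coboundary of the potential [f]; these functions form the cut space. *)
Definition grad f : V := [ffun e => f (head e) - f (tail e)].

Definition cut x : V := grad (fun y => (y == x)%:R).

Lemma cutE x e : cut x e = (head e == x)%:R - (tail e == x)%:R.
Proof. by rewrite ffunE. Qed.

Lemma dot_cut F x :
  dot F (cut x) = \sum_(e | head e == x) F e - \sum_(e | tail e == x) F e.
Proof.
rewrite /dot [X in X - _]big_mkcond [X in _ - X]big_mkcond -sumrB.
apply: eq_bigr => e _; rewrite cutE mulrBr.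
by congr (_ - _); case: eqP; rewrite ?mulr1 ?mulr0.
Qed.

Lemma cycle_spaceP F : cycle F <-> forall x, dot F (cut x) = 0.
Proof.
split=> FZ x; last by apply/eqP; rewrite -subr_eq0 -dot_cut FZ.
by rewrite dot_cut; apply/eqP; rewrite subr_eq0; apply/eqP/FZ.
Qed.

(** Summation by parts: [grad f] is the combination of the vertex cuts with coefficients [f x]. *)
Lemma dot_grad F f : dot F (grad f) = \sum_x f x * dot F (cut x).
Proof.
under eq_bigr => x _ do rewrite big_distrr /=.
rewrite exchange_big; apply: eq_bigr => e _ /=.
under eq_bigr => x _ do rewrite mulrCA.
rewrite -big_distrr /= ffunE; congr (_ * _).
under eq_bigr => x _ do rewrite cutE mulrBr.
rewrite sumrB; congr (_ - _).
  rewrite (bigD1 (head e)) //= eqxx mulr1 big1 ?addr0 // => x /negPf.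
  by rewrite eq_sym => ->; rewrite mulr0.
rewrite (bigD1 (tail e)) //= eqxx mulr1 big1 ?addr0 // => x /negPf.
by rewrite eq_sym => ->; rewrite mulr0.
Qed.

Lemma dot_cycle_grad F f : cycle F -> dot F (grad f) = 0.
Proof.
by move/cycle_spaceP => FZ; rewrite dot_grad big1 // => x _; rewrite FZ mulr0.
Qed.

Lemma cycle_spaceD F G : cycle F -> cycle G -> cycle (F + G).
Proof.
move=> /cycle_spaceP FZ /cycle_spaceP GZ; apply/cycle_spaceP => x.
by rewrite dotDl FZ GZ addr0.
Qed.

Lemma cycle_spaceZ a F : cycle F -> cycle (a *: F).
Proof.
by move=> /cycle_spaceP FZ; apply/cycle_spaceP => x; rewrite dotZl FZ mulr0.
Qed.

(** The divergence [b] has the cycle space as kernel, and the gradient [g] is its adjoint, so kernel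
    and image are orthogonal. They span by a dimension count, [g] being injective on the image of
    [b]. *)
Lemma cycle_projection : exists P : 'End(V),
  forall F, cycle (P F) /\ exists f, F = P F + grad f.
Proof.
have bL : linear (fun F => [ffun x => dot F (cut x)] : {ffun T -> R^o}).
  by move=> a F G; apply/ffunP => x; rewrite !ffunE dotDl dotZl.
have gL : linear (fun f : {ffun T -> R^o} => grad f).
  move=> a f g; apply/ffunP => e; rewrite !ffunE.
  by rewrite scalerBr addrACA opprD.
have [b bE] := exists_linfun bL; have [g gE] := exists_linfun gL.
have kerE F : (F \in lker b) <-> cycle F.
  rewrite memv_ker bE cycle_spaceP; split=> [/eqP/ffunP F0 x|F0].
    by have := F0 x; rewrite !ffunE.
  by apply/eqP/ffunP => x; rewrite !ffunE F0.
have I0 : (lker b :&: limg g)%VS = 0%VS.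
  apply/eqP; rewrite -subv0; apply/subvP => F /memv_capP[/kerE FZ].
  case/memv_imgP => f _ FE; rewrite memv0; apply/eqP/dot_self_eq0.
  by rewrite {2}FE gE dot_cycle_grad.
(* If [f = b F] and [grad f = 0], adjointness makes the sum of the squares of [f] equal to
   [dot F (grad f) = 0]. *)
have I1 : (limg b :&: lker g)%VS = 0%VS.
  apply/eqP; rewrite -subv0; apply/subvP => f /memv_capP[/memv_imgP[F _ fE]].
  rewrite memv_ker gE memv0 => /eqP gf0.
  have: \sum_x (f x : R) * (f x : R) = 0.
    under eq_bigr => x _ do rewrite {2}fE bE ffunE.
    by rewrite -dot_grad gf0 /dot big1 // => e _; rewrite ffunE mulr0.
  move/eqP; rewrite psumr_eq0 => [/allP f0|x _]; last by rewrite -expr2 sqr_ge0.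
  apply/eqP/ffunP => x; rewrite ffunE; apply/eqP.
  by have := f0 x (mem_index_enum x); rewrite /= mulf_eq0 orbb.
have full : (lker b + limg g)%VS = fullv.
  apply/eqP; rewrite eqEdim subvf dimv_disjoint_sum //.
  rewrite -(limg_ker_dim b fullv) capfv leq_add2l.
  by rewrite -(limg_dim_eq I1) dimvS // limgS // subvf.
exists (daddv_pi (lker b) (limg g)) => F; split.
  exact/kerE/memv_pi.
have := memvf F; rewrite -full => /(daddv_pi_add I0) FE.
have /memv_imgP[f _ fE] := memv_pi (limg g) (lker b) F.
by exists f; rewrite -gE -fE FE.
Qed.

Lemma cycle_add_grad_eq0 z f :
  cycle z -> (forall z', cycle z' -> dot (z + grad f) z' = 0) -> z = 0.
Proof.
move=> zZ ort; apply: dot_self_eq0; rewrite -{}[RHS](ort z zZ).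
by rewrite dotDl [dot (grad f) z]dotC dot_cycle_grad ?addr0.
Qed.

Lemma orthogonal_cycle_grad F :
  (forall z, cycle z -> dot F z = 0) -> exists f, F = grad f.
Proof.
have [P PP] := cycle_projection => ort.
have [PZ [f FE]] := PP F; exists f.
by rewrite {1}FE (@cycle_add_grad_eq0 (P F) f) ?add0r // => z zZ; rewrite -FE ort.
Qed.

(** * Isometries of the l1-norm *)

(** Such a linear [phi] sends [delta e] to [s e *: delta (p e)]; that [s e] is 1 or -1 is expressed
    by its square. *)
Definition signed_perm (phi : V -> V) (p : E -> E) (s : E -> R) : Prop :=
  [/\ injective p, forall e, s e * s e = 1 & forall F e, phi F (p e) = s e * F e].

Lemma delta_sum F : F = \sum_e F e *: delta e.
Proof.
apply/ffunP => e; rewrite sum_ffunE (bigD1 e) //= big1 ?addr0.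
  by rewrite !ffunE eqxx /= -[F e *: 1]/(F e * 1) mulr1.
by move=> e' /negPf ne; rewrite !ffunE eq_sym ne -[LHS]/(F e' * 0) mulr0.
Qed.

Lemma l1_norm_delta e : l1_norm (delta e) = 1.
Proof.
rewrite /l1_norm (bigD1 e) //= big1 ?addr0; first by rewrite ffunE eqxx normr1.
by move=> e' /negPf ne; rewrite ffunE ne normr0.
Qed.

Lemma l1_norm_delta2 e e' (s : R) : `|s| = 1 -> e != e' ->
  l1_norm (delta e + s *: delta e') = 2.
Proof.
move=> s1 ne; rewrite -[2](_ : l1_norm (delta e) + l1_norm (delta e') = _).
  rewrite /l1_norm -big_split; apply: eq_bigr => a _; rewrite !ffunE.
  rewrite -[s *: _]/(s * _); case: eqP => [->|_]; case: eqP => [E|_] /=.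
  - by rewrite E eqxx in ne.
  - by rewrite mulr0 !addr0 normr0 addr0.
  - by rewrite add0r mulr1 s1 normr1 normr0 add0r.
  - by rewrite mulr0 !addr0 normr0 addr0.
by rewrite !l1_norm_delta.
Qed.

Lemma parallelogram_l1_le (a b : R) : `|a + b| + `|a - b| <= 2 * (`|a| + `|b|).
Proof. have := ler_normD a b; have := ler_normB a b; lra. Qed.

(** The left side is twice the larger of the two absolute values, so equality forces the smaller to
    vanish. *)
Lemma parallelogram_l1_eq (a b : R) :
  `|a + b| + `|a - b| = 2 * (`|a| + `|b|) -> a = 0 \/ b = 0.
Proof.
move=> H; suff : (a == 0) || (b == 0) by case/orP => /eqP; [left|right].
apply: contraT; rewrite negb_or => /andP[].
rewrite !neq_lt => /orP[]a0 /orP[]b0; exfalso; move: H;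
  case: (ger0P (a + b)) => ?; case: (ger0P (a - b)) => ?;
  case: (ger0P a) => ?; case: (ger0P b) => ?; lra.
Qed.

(** The sum and the difference of two distinct unit vectors both have norm 2, so
    [parallelogram_l1_le] is an equality at every coordinate of their images, which thus have
    disjoint supports. A point chosen in each support gives an injection [p], onto by finiteness, so
    the supports are singletons. *)
Lemma l1_isometry_signed_perm phi :
  (forall F, l1_norm (phi F) = l1_norm F) -> exists p s, signed_perm phi p s.
Proof.
move=> iso; pose a e : V := phi (delta e).
have disj (e f g : E) : e != f -> a e g = 0 \/ a f g = 0.
  move=> ne.
  have: \sum_g (2 * (`|a e g : R| + `|a f g : R|)
                - (`|a e g + a f g : R| + `|a e g - a f g : R|)) = 0.
    rewrite sumrB -mulr_sumr !big_split /=.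
    have nrm h : \sum_g `|a h g : R| = 1.
      by rewrite -[LHS]/(l1_norm (a h)) iso l1_norm_delta.
    have nrmS (s : R) : `|s| = 1 -> \sum_g `|a e g + (s *: a f) g : R| = 2.
      move=> s1; rewrite -(l1_norm_delta2 s1 ne) -iso linearD linearZ /=.
      by rewrite /l1_norm; apply: eq_bigr => h _; rewrite [in RHS]ffunE.
    have -> : \sum_g `|a e g + a f g : R| = 2.
      by rewrite -(nrmS 1 (normr1 _)); apply: eq_bigr => h _; rewrite scale1r.
    have -> : \sum_g `|a e g - a f g : R| = 2.
      rewrite -[RHS](nrmS (-1)) ?normrN1 //.
      by apply: eq_bigr => h _; rewrite scaleN1r [(- a f) h]ffunE.
    by rewrite !nrm; lra.
  move/eqP; rewrite psumr_eq0 => [/allP/(_ g (mem_index_enum g))|h _].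
    by rewrite /= subr_eq0 => /eqP /esym; apply: parallelogram_l1_eq.
  by rewrite subr_ge0 parallelogram_l1_le.
have [p pP] : exists p : E -> E, forall e, a e (p e) != 0.
  apply: (@fin_all_exists _ _ (fun e g => is_true (a e g != 0))) => e.
  apply/existsP; apply: contraT; rewrite negb_exists => /forallP a0.
  have := iso (delta e); rewrite l1_norm_delta /l1_norm big1.
    by move/esym/eqP; rewrite oner_eq0.
  by move=> g _; have := a0 g; rewrite negbK => /eqP ->; rewrite normr0.
exists p, (fun e => a e (p e)).
have a0 (e f : E) : e != f -> a e (p f) = 0.
  by move=> ne; case: (disj e f (p f) ne) => // /eqP; rewrite (negPf (pP f)).
have pI : injective p.
  move=> e f pef; apply/eqP; apply: contraT => /a0.
  by rewrite -pef => /eqP; rewrite (negPf (pP e)).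
split=> // [e|F e]; last first.
  rewrite {1}[F]delta_sum linear_sum sum_ffunE (bigD1 e) //= big1 ?addr0.
    by rewrite linearZ ffunE /= mulrC.
  by move=> f ne; rewrite linearZ ffunE a0 // -[LHS]/(F f * 0) mulr0.
have := iso (delta e); rewrite l1_norm_delta /l1_norm.
rewrite (reindex_inj pI) (bigD1 e) //= big1 ?addr0 => [|f ne]; last first.
  by rewrite -/(a e) a0 ?normr0 // eq_sym.
by move=> n1; rewrite -[RHS](expr1n _ 2) -n1 real_normK ?num_real.
Qed.

End Graph.

(** * Flows along edges and paths *)

Section Flows.
Variables (R : realType) (T : finType) (r : rel T).
Variables (tail head : edge r -> T).
Hypothesis orient : is_orientation tail head.
Hypotheses (rsym : symmetric r) (rirr : irreflexive r).
Local Notation E := (edge r).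
Local Notation V := (edge_space R r).
Local Notation cycle := (in_cycle_space tail head).
Local Notation cut := (@cut R T r tail head).
Local Notation grad := (@grad R T r tail head).
Local Notation delta := (@delta R T r).
Implicit Types (F G z : V) (e : E) (x y u v w : T) (f : T -> R) (phi : 'End(V)).

Lemma edge_adj e : r (tail e) (head e).
Proof.
have /imset2P[x y _] := edge_endsP e; rewrite inE orient => /andP[_ rxy] eE.
have nxy : x != y by apply: contraTneq rxy => ->; rewrite rirr.
have xE : x \in [set tail e; head e] by rewrite eE set21.
have yE : y \in [set tail e; head e] by rewrite eE set22.
have := set21 (tail e) (head e); have := set22 (tail e) (head e).
rewrite {1 2}eE => /set2P[]hE /set2P[]tE; move: xE yE; rewrite hE tE !inE ?orbb.
- by rewrite [y == x]eq_sym (negPf nxy).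
- by rewrite rsym.
- by [].
- by rewrite (negPf nxy).
Qed.

Lemma head_neq_tail e : head e != tail e.
Proof. by apply: contraTneq (edge_adj e) => ->; rewrite rirr. Qed.

Lemma edge_inj e e' : tail e = tail e' -> head e = head e' -> e = e'.
Proof. by move=> t h; apply: val_inj; rewrite /= !orient t h. Qed.

Lemma edge_inj_rev e e' : tail e = head e' -> head e = tail e' -> e = e'.
Proof. by move=> t h; apply: val_inj; rewrite /= !orient t h setUC. Qed.

Lemma edge_exists x y : r x y ->
  exists e, (tail e = x /\ head e = y) \/ (tail e = y /\ head e = x).
Proof.
move=> rxy; have nxy : x != y by apply: contraTneq rxy => ->; rewrite rirr.
have eP : [set x; y] \in edge_set r by apply/imset2P; exists x y; rewrite ?inE.
exists (Edge eP); have /= eE := orient (Edge eP); move: eE.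
set t := tail _; set h := head _ => eE.
have nth : h != t := head_neq_tail (Edge eP).
have := set21 t h; have := set22 t h; rewrite -eE !inE.
move=> /orP[]/eqP hE /orP[]/eqP tE; rewrite hE tE ?eqxx in nth *; by [left|right|].
Qed.

(* The signed unit vector of the edge {x, y} traversed from x to y; it is 0 if
   there is no such edge. *)
Definition dart x y : V :=
  [ffun e => ((tail e == x) && (head e == y))%:R
             - ((tail e == y) && (head e == x))%:R].

Lemma dartC x y : dart y x = - dart x y.
Proof. by apply/ffunP => e; rewrite !ffunE opprB. Qed.

Lemma dart_delta e : dart (tail e) (head e) = delta e.
Proof.
apply/ffunP => e'; rewrite !ffunE; case: (e' =P e) => [->|ne].
  by rewrite !eqxx (eq_sym (tail e)) (negPf (head_neq_tail e)) subr0.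
have /negPf-> : ~~ ((tail e' == tail e) && (head e' == head e)).
  by apply/negP => /andP[/eqP t /eqP h]; apply/ne/edge_inj.
have /negPf-> : ~~ ((tail e' == head e) && (head e' == tail e)).
  by apply/negP => /andP[/eqP t /eqP h]; apply/ne/edge_inj_rev.
by rewrite subrr.
Qed.

Lemma dart_signed_delta x y : r x y -> exists e (s : bool),
  [/\ dart x y = (-1) ^+ s *: delta e, edge_ends e = [set x; y]
    & (if s then head e else tail e) = x].
Proof.
case/edge_exists => e [[<- <-]|[<- <-]]; [exists e, false|exists e, true].
  by rewrite scale1r dart_delta orient.
by rewrite dartC dart_delta scaleN1r orient setUC.
Qed.

Lemma dot_dart_grad x y f : r x y -> dot (dart x y) (grad f) = f y - f x.
Proof.
case/edge_exists => e [[<- <-]|[<- <-]].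
  by rewrite dart_delta dotC dot_delta ffunE.
by rewrite dartC dotNl dart_delta dotC dot_delta ffunE opprB.
Qed.

Definition inc e x := x \in edge_ends e.

Lemma incE e x : inc e x = (x == tail e) || (x == head e).
Proof. by rewrite /inc orient !inE. Qed.

Lemma cut_off e x : ~~ inc e x -> cut x e = 0.
Proof.
rewrite incE negb_or cutE ![x == _]eq_sym.
by move=> /andP[/negPf-> /negPf->]; rewrite subrr.
Qed.

Lemma cut_neq0 e x : inc e x -> cut x e != 0.
Proof.
rewrite incE cutE => /orP[]/eqP->; rewrite eqxx.
  by rewrite (negPf (head_neq_tail e)) sub0r oppr_eq0 oner_eq0.
by rewrite [tail e == _]eq_sym (negPf (head_neq_tail e)) subr0 oner_eq0.
Qed.

Lemma dart_off x y e : edge_ends e != [set x; y] -> dart x y e = 0.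
Proof.
move=> ne; rewrite ffunE.
have /negPf-> : ~~ ((tail e == x) && (head e == y)).
  by apply: contra ne => /andP[/eqP<- /eqP<-]; rewrite orient.
have /negPf-> : ~~ ((tail e == y) && (head e == x)).
  by apply: contra ne => /andP[/eqP<- /eqP<-]; rewrite orient setUC.
by rewrite subrr.
Qed.

(** Sum the darts along a path. The pairing with gradients says that [F] is a unit flow from [w] to
    [w']. *)
Lemma flow_within (A : {set T}) w w' : connect (within r A) w w' ->
  exists F, (forall f, dot F (grad f) = f w' - f w) /\
            (forall e, ~~ (edge_ends e \subset A) -> F e = 0).
Proof.
case/connectP => p; elim: p w => [|x p IHp] w /= => [_ ->|/andP[/and3P[rwx wA xA]]].
  exists 0; split=> [f|e _]; last by rewrite ffunE.
  by rewrite subrr /dot big1 // => e _; rewrite ffunE mul0r.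
move=> /IHp{}IHp /IHp[F [Fd F0]]; exists (dart w x + F); split=> [f|e eA].
  by rewrite dotDl Fd dot_dart_grad // addrC subrKA.
rewrite ffunE F0 // addr0 dart_off //; apply: contra eA => /eqP->.
by rewrite subUset !sub1set wA.
Qed.

End Flows.

(** * Isometries preserving the cycle space *)

Section Whitney.
Variables (R : realType) (T : finType) (r : rel T).
Variables (tail head : edge r -> T).
Hypothesis orient : is_orientation tail head.
Hypotheses (rsym : symmetric r) (rirr : irreflexive r).
Hypothesis conn3 : forall u v w w', w \notin [set u; v] -> w' \notin [set u; v] ->
  connect (within r (~: [set u; v])) w w'.
Hypothesis deg3 : forall v u u', exists w, [/\ r v w, w != u & w != u'].
Local Notation E := (edge r).
Local Notation V := (edge_space R r).
Local Notation cycle := (in_cycle_space tail head).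
Local Notation cut := (@cut R T r tail head).
Local Notation grad := (@grad R T r tail head).
Local Notation delta := (@delta R T r).
Local Notation dart := (@dart R T r tail head).
Implicit Types (F G z : V) (e : E) (x y u v w : T) (f g : T -> R) (S : pred E).

Lemma inc_dart e u : inc e u -> exists w (s : R),
  [/\ r u w, edge_ends e = [set u; w] & dart u w = s *: delta e].
Proof.
have re := edge_adj orient rsym rirr e.
rewrite (incE orient) => /orP[]/eqP->.
  exists (head e), 1; split=> //.
  by rewrite scale1r (dart_delta R orient).
exists (tail e), (-1); split; first by rewrite rsym.
  by rewrite orient setUC.
by rewrite dartC (dart_delta R orient) // scaleN1r.
Qed.

(** Pair [grad f] with a unit flow from [w] to [w'] inside [A]. *)
Lemma grad_const (A : {set T}) f w w' : connect (within r A) w w' ->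
  (forall e, edge_ends e \subset A -> grad f e = 0) -> f w = f w'.
Proof.
case/(flow_within R orient rsym rirr) => F [Fd F0] f0.
apply/esym/eqP; rewrite -subr_eq0 -Fd /dot big1 // => e _.
have [eA|/F0->] := boolP (edge_ends e \subset A); last by rewrite mul0r.
by rewrite f0 // mulr0.
Qed.

(** Vertex cuts have minimal support among gradients: the graph minus [v] is connected, so [f] takes
    a single value off [v]. *)
Lemma cut_minimal v f : (forall e, ~~ inc e v -> grad f e = 0) ->
  exists a : R, grad f = a *: cut v.
Proof.
move=> f0; have [w [rvw wv _]] := deg3 v v v.
have fE x : f x = f w + (f v - f w) * (x == v)%:R.
  have [->|xv] := eqVneq x v; first by rewrite mulr1 addrC subrK.
  rewrite mulr0 addr0.
  apply: (@grad_const (~: [set v; v])).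
    by apply: conn3; rewrite setUid inE.
  move=> e eA; apply: f0; apply/negP => /(subsetP eA).
  by rewrite setUid !inE eqxx.
exists (f v - f w); apply/ffunP => e.
rewrite [LHS]ffunE [RHS]ffunE cutE fE [f (tail e)]fE.
by rewrite -[RHS]/((f v - f w) * _) mulrBr opprD addrACA subrr add0r.
Qed.

Definition res S F : V := [ffun e => (S e)%:R *: F e].

(** A path from [w] to [w'] avoiding [u] and [v] is closed up by two edges at [u]; [F] is the flow
    along it. *)
Lemma cycle_through u v w w' : r u w -> r u w' -> w != v -> w' != v ->
  exists F, cycle (dart u w - dart u w' + F) /\
    (forall e, inc e u || inc e v -> F e = 0).
Proof.
move=> ruw ruw' wv w'v.
have nin x : r u x -> x != v -> x \notin [set u; v].
  move=> rux xv; rewrite !inE negb_or xv andbT.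
  by apply: contraTneq rux => ->; rewrite rirr.
have [F [Fd F0]] := flow_within R orient rsym rirr
  (conn3 (nin _ ruw wv) (nin _ ruw' w'v)).
exists F; split=> [|e euv].
  apply/cycle_spaceP => x.
  rewrite !dotDl dotNl Fd !(dot_dart_grad orient rsym rirr) //; lra.
apply: F0; apply/negP => /subsetP sE; case/orP: euv => /sE; rewrite !inE eqxx //.
by rewrite orbT.
Qed.

(* [splitS] says that [S] splits the cycle space of the graph minus [v] into two
   complementary coordinate subspaces.  A cycle through two edges at [u], one in
   [S] and one not, would be cut by [S] into non-cycles. *)
Section Split.
Variables (v : T) (S : pred E).
Hypothesis splitS : forall z, cycle z -> (forall e, inc e v -> z e = 0) ->
  cycle (res S z).

Lemma split_adjacent u a b : inc a u -> inc b u -> ~~ inc a v -> ~~ inc b v ->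
  S a = S b.
Proof.
move=> au bu av bv.
have uv : u != v by apply: contra av => /eqP<-.
have [w [s [ruw aE dartA]]] := inc_dart au.
have [w' [s' [ruw' bE dartB]]] := inc_dart bu.
have other x e : edge_ends e = [set u; x] -> ~~ inc e v -> x != v.
  by move=> eE; apply: contraNneq => <-; rewrite /inc eE set22.
have [F [zZ F0]] := cycle_through ruw ruw' (other _ _ aE av) (other _ _ bE bv).
have zv e : inc e v -> (dart u w - dart u w' + F) e = 0.
  move=> ev; rewrite ffunE F0 ?ev ?orbT // dartA dartB !ffunE.
  have /negPf-> : e != a by apply: contraTneq ev => ->.
  have /negPf-> : e != b by apply: contraTneq ev => ->.
  by rewrite !scaler0 subrr addr0.
have resE : res S (dart u w - dart u w' + F) =
    (S a)%:R *: dart u w - (S b)%:R *: dart u w' + res S F.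
  apply/ffunP => e; rewrite dartA dartB !ffunE.
  rewrite !scalerDr scalerN; congr (_ - _ + _).
    by case: eqP => [->//|_]; rewrite !scaler0.
  by case: eqP => [->//|_]; rewrite !scaler0.
(* Only the two darts of the restricted cycle have divergence at [u], so its vanishing there
   compares [S a] with [S b]. *)
have /cycle_spaceP/(_ u) := splitS zZ zv.
rewrite resE !dotDl dotNl !dotZl !(dot_dart_grad orient rsym rirr) // eqxx.
have -> : dot (res S F) (cut u) = 0.
  rewrite /dot big1 // => e _; have [eu|eu] := boolP (inc e u).
    by rewrite ffunE F0 ?eu // scaler0 mul0r.
  by rewrite (cut_off _ orient eu) mulr0.
have /negPf-> : w != u by apply: contraTneq ruw => ->; rewrite rirr.
have /negPf-> : w' != u by apply: contraTneq ruw' => ->; rewrite rirr.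
case: (S a); case: (S b) => //= /eqP;
  rewrite !(mul0r, mul1r, sub0r, subr0, addr0, opprK) ?oppr_eq0 oner_eq0 //.
Qed.

(** Propagate along a path in the graph minus [v]: consecutive edges share a vertex, where
    [split_adjacent] applies. *)
Lemma split_const a b : ~~ inc a v -> ~~ inc b v -> S a = S b.
Proof.
move=> av bv.
have ta : inc a (tail a) by rewrite (incE orient) eqxx.
have tb : inc b (tail b) by rewrite (incE orient) eqxx.
have nin e x : ~~ inc e v -> inc e x -> x \notin [set v; v].
  by move=> ev ex; rewrite setUid inE; apply: contra ev => /eqP<-.
have /connectP[p] := conn3 (nin _ _ av ta) (nin _ _ bv tb).
move: (tail a) ta => x; elim: p x a av => [|y p IHp] x a av ax /=.
  by move=> _ tbE; apply: split_adjacent av bv; [exact: ax|rewrite -tbE].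
case/andP => /and3P[rxy xA yA] pth lst.
have [e eP] := edge_exists orient rsym rirr rxy.
have [ex ey] : inc e x /\ inc e y.
  by rewrite !(incE orient); case: eP => [[-> ->]|[-> ->]]; rewrite !eqxx ?orbT.
have ev : ~~ inc e v.
  move: xA yA; rewrite (incE orient) setUid !inE ![v == _]eq_sym.
  by case: eP => [[-> ->]|[-> ->]] /negPf-> /negPf->.
by rewrite (split_adjacent ax ex av ev); apply: IHp ev ey pth lst.
Qed.

End Split.

(** * From isometries of the cycle space to graph automorphisms *)

Section CycleIsometry.
Variables (phi : 'End(V)) (p : E -> E) (s : E -> R).
Hypothesis phiS : signed_perm phi p s.
Hypothesis phiZ : forall F, cycle F <-> exists2 F', cycle F' & phi F' = F.

Let pI : injective p. Proof. by case: phiS. Qed.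
Let ss e : s e * s e = 1. Proof. by case: phiS => _ ->. Qed.
Let phiE F e : phi F (p e) = s e * F e. Proof. by case: phiS => _ _ ->. Qed.

Let s_neq0 e : s e != 0.
Proof. by apply/eqP => s0; have /eqP := ss e; rewrite s0 mul0r eq_sym oner_eq0. Qed.

Let phi_eq0 F e : (phi F (p e) == 0) = (F e == 0).
Proof. by rewrite phiE mulf_eq0 (negPf (s_neq0 e)). Qed.

Lemma signed_perm_onto e : exists e', e = p e'.
Proof. by exists (invF pI e); rewrite f_invF. Qed.

Lemma signed_perm_inj : injective phi.
Proof.
move=> F G FG; apply/ffunP => e; apply: (mulfI (s_neq0 e)).
by rewrite -!phiE FG.
Qed.

Lemma signed_perm_inv G : phi [ffun e => s e * G (p e)] = G.
Proof.
apply/ffunP => e; have [e' ->] := signed_perm_onto e.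
by rewrite phiE ffunE mulrA ss mul1r.
Qed.

Lemma dot_signed_perm F G : dot (phi F) (phi G) = dot F G.
Proof.
rewrite /dot (reindex_inj pI); apply: eq_bigr => e _ /=.
by rewrite !phiE mulrACA ss mul1r.
Qed.

Lemma signed_perm_cycle F : cycle (phi F) <-> cycle F.
Proof.
rewrite phiZ; split=> [[F' F'Z /signed_perm_inj <-]//|FZ].
by exists F.
Qed.

Lemma signed_perm_grad f : exists g, phi (grad f) = grad g.
Proof.
apply: orthogonal_cycle_grad => z /phiZ[z' z'Z <-].
by rewrite dot_signed_perm dotC dot_cycle_grad.
Qed.

Lemma signed_perm_grad_inv g : exists f, phi (grad f) = grad g.
Proof.
have [|f fE] :=
  @orthogonal_cycle_grad R T r tail head [ffun e => s e * grad g (p e)].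
  move=> z /signed_perm_cycle zZ.
  by rewrite -dot_signed_perm signed_perm_inv dotC dot_cycle_grad.
by exists f; rewrite -fE signed_perm_inv.
Qed.

(** Minimality of support carries over from [cut v], since [phi] permutes supports and every
    gradient is the image of a gradient. *)
Lemma image_cut_minimal v g : (forall e, phi (cut v) e = 0 -> grad g e = 0) ->
  exists a : R, grad g = a *: phi (cut v).
Proof.
move=> g0; have [f fE] := signed_perm_grad_inv g.
have [|a aE] := @cut_minimal v f.
  move=> e ev; apply/eqP; rewrite -phi_eq0 fE; apply/eqP/g0/eqP.
  by rewrite phi_eq0 (cut_off _ orient ev).
by exists a; rewrite -fE aE linearZ.
Qed.

(** For [u] other than [v] the edge tells the two vertices apart; [u = v] merely asks for an edge at
    [v]. *)
Lemma inc_neighbour v u : exists2 e : E, inc e v & ~~ inc e u || (v == u).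
Proof.
have [w [rvw wu _]] := deg3 v u u.
have [e eP] := edge_exists orient rsym rirr rvw; exists e.
  by rewrite (incE orient); case: eP => [[-> ->]|[-> ->]]; rewrite eqxx ?orbT.
have [//|vu] := eqVneq v u; first by rewrite orbT.
rewrite (incE orient) orbF ![u == _]eq_sym.
by case: eP => [[-> ->]|[-> ->]]; rewrite (negPf wu) (negPf vu).
Qed.

Lemma cut_sq e x : inc e x -> cut x e * cut x e = 1.
Proof.
move=> ex; have := cut_neq0 R orient rsym rirr ex; rewrite cutE.
by case: (head e == x); case: (tail e == x);
  rewrite ?(subrr, subr0, sub0r, eqxx, mulr1, mulrNN).
Qed.

Definition independent (W : {set T}) := forall e, ~~ (edge_ends e \subset W).

(* The complement of the cut [grad 1_U] splits into the edges inside [U] and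
   those inside [~: U]; [split_const] rules out that both kinds occur. *)
Lemma image_cut_side v (U : {set T}) :
  (forall e, (phi (cut v) e == 0) = ((head e \in U) == (tail e \in U))) ->
  independent U \/ independent (~: U).
Proof.
move=> bE.
case: (pickP (fun e => edge_ends e \subset U)) => [eU inU|iU]; last first.
  by left=> e; rewrite iU.
case: (pickP (fun e => edge_ends e \subset ~: U)) => [eW inW|iW]; last first.
  by right=> e; rewrite iW.
exfalso.
pose S' e := edge_ends e \subset U.
have S'E e : S' e = (tail e \in U) && (head e \in U).
  by rewrite /S' orient subUset !sub1set.
pose S e := S' (p e).
have splitS z : cycle z -> (forall e, inc e v -> z e = 0) -> cycle (res S z).
  move=> zZ z0; apply/signed_perm_cycle.
  have -> : phi (res S z) = res S' (phi z).
    apply/ffunP => e; have [e' ->] := signed_perm_onto e.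
    rewrite phiE !ffunE phiE -[_ *: z e']/(_ * _) -[RHS]/(_ * _).
    by rewrite mulrCA.
  have y0 e : phi (cut v) e != 0 -> phi z e = 0.
    have [e' ->] := signed_perm_onto e; rewrite phi_eq0 => ne; apply/eqP.
    rewrite phi_eq0 z0 //; apply: contraR ne => ev.
    by rewrite (cut_off _ orient ev).
  move/signed_perm_cycle: zZ => /cycle_spaceP yZ; apply/cycle_spaceP => x.
  (* An edge at [x] that carries [phi z] lies outside the image cut, so both its ends are on the
     side of [x]: restriction to [S'] keeps all or none of the divergence at [x]. *)
  have -> : dot (res S' (phi z)) (cut x) = (x \in U)%:R * dot (phi z) (cut x).
    rewrite /dot big_distrr; apply: eq_bigr => e _ /=.
    rewrite ffunE -[_ *: _]/(_ * _) -mulrA.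
    have [b0|/y0->] := boolP (phi (cut v) e == 0); last by rewrite !mul0r !mulr0.
    have [ex|ex] := boolP (inc e x); last by rewrite (cut_off _ orient ex) !mulr0.
    congr (_%:R * _); rewrite S'E; move: b0 ex; rewrite bE => /eqP hU.
    by rewrite (incE orient) => /orP[]/eqP->; rewrite hU andbb.
  by rewrite yZ mulr0.
have [a aE] := signed_perm_onto eU; have [a' a'E] := signed_perm_onto eW.
have off e : phi (cut v) (p e) == 0 -> ~~ inc e v.
  by rewrite phi_eq0; apply: contraTN => /(cut_neq0 R orient rsym rirr).
have tW : tail eW \notin U.
  by move: inW; rewrite orient subUset !sub1set !inE => /andP[].
have : S a = S a'.
  apply: (split_const splitS); apply: off; rewrite -?aE -?a'E bE.
    by move: inU; rewrite orient subUset !sub1set => /andP[-> ->].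
  by move: inW; rewrite orient subUset !sub1set !inE => /andP[/negPf-> /negPf->].
rewrite /S -aE -a'E [S' eW]S'E (negPf tW) /=.
by rewrite /S' inU.
Qed.

(** By minimality the image is, up to a scalar, the cut between a level set [U] and its complement.
    One of these is independent, and a vertex of it serves as [w]. *)
Lemma image_cut v : exists w (c : R), c * c = 1 /\ phi (cut v) = c *: cut w.
Proof.
have [f fE] := signed_perm_grad (fun y => (y == v)%:R); rewrite -/(cut v) in fE.
have [e1 e1v _] := inc_neighbour v v.
have b1 : phi (cut v) (p e1) != 0 by rewrite phi_eq0 (cut_neq0 R orient rsym rirr).
set a1 := p e1 in b1.
have f1 : f (head a1) != f (tail a1) by move: b1; rewrite fE ffunE subr_eq0.
(* [f] separates the ends of [a1], so neither [U] nor its complement is empty. *)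
pose U := [set x | f x == f (tail a1)].
have [|a aE] := @image_cut_minimal v (fun x => (x \in U)%:R).
  move=> e; rewrite fE !ffunE !inE => /eqP; rewrite subr_eq0 => /eqP->.
  by rewrite subrr.
have bE e : (phi (cut v) e == 0) = ((head e \in U) == (tail e \in U)).
  have ae : (head e \in U)%:R - (tail e \in U)%:R = a * phi (cut v) e.
    by move/ffunP/(_ e): aE; rewrite !ffunE.
  have a0 : a != 0.
    apply/eqP => a0; move/ffunP/(_ a1): aE; rewrite a0 scale0r !ffunE !inE eqxx.
    by rewrite (negPf f1) sub0r => /eqP; rewrite oppr_eq0 oner_eq0.
  transitivity (a * phi (cut v) e == 0); first by rewrite mulf_eq0 (negPf a0).
  rewrite -ae subr_eq0; case: (head e \in U); case: (tail e \in U);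
    by rewrite ?eqxx // ?oner_eq0 // eq_sym oner_eq0.
have [W [x xW]] : exists W : {set T}, exists2 x, x \in W & independent W /\
    forall e, (phi (cut v) e == 0) = ((head e \in W) == (tail e \in W)).
  case: (image_cut_side bE) => indep.
    by exists U, (tail a1); rewrite ?inE.
  exists (~: U), (head a1); rewrite ?inE //; split=> // e; rewrite bE !in_setC.
  by case: (_ \in U); case: (_ \in U).
case=> indep bW.
(* Every edge at [x] leaves the independent set [W], so the support of [cut x] lies in that of the
   image cut. *)
have [|c cE] := @image_cut_minimal v (fun y => (y == x)%:R).
  move=> e /eqP; rewrite bW => /eqP hW; apply: (cut_off _ orient).
  apply/negP; rewrite (incE orient) => ex; case/negP: (indep e).
  rewrite orient subUset !sub1set.
  by case/orP: ex => /eqP xE; move: hW xW; rewrite xE => -> ->.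
rewrite -/(cut x) in cE.
have [e2 e2x _] := inc_neighbour x x.
have c0 : c != 0.
  apply/eqP => c0; have := cut_neq0 R orient rsym rirr e2x.
  by rewrite cE c0 scale0r ffunE eqxx.
(* Both cuts take a value 1 or -1 on [a1]. *)
have cc : c * c = 1.
  have b2 : phi (cut v) a1 * phi (cut v) a1 = 1.
    by rewrite phiE mulrACA ss mul1r cut_sq.
  have x1 : cut x a1 = c * phi (cut v) a1 by rewrite cE ffunE.
  have : inc a1 x.
    apply: contraT => /(cut_off R orient)/eqP.
    by rewrite x1 mulf_eq0 (negPf c0) (negPf b1).
  by move/cut_sq; rewrite x1 mulrACA b2 mulr1.
by exists x, c; split=> //; rewrite cE scalerA cc scale1r.
Qed.

Lemma cut_mul e x y : edge_ends e = [set x; y] -> x != y -> cut x e * cut y e = -1.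
Proof.
rewrite orient => eE xy; rewrite !cutE.
have := set21 (tail e) (head e); have := set22 (tail e) (head e).
have := head_neq_tail orient rsym rirr e.
rewrite {1 2}eE => ht /set2P[]hE /set2P[]tE; move: ht; rewrite hE tE ?eqxx // => _;
  rewrite ?[y == x]eq_sym (negPf xy) ?eqxx /= subr0 sub0r ?mulr1 ?mul1r //.
Qed.

(** Adjacency is thereby read off the supports of the cuts, which [phi] permutes. *)
Lemma cut_adjE x y : reflect (exists2 e : E, cut x e != 0 & cut y e != 0)
  (r x y || (x == y)).
Proof.
have ninc (z : T) e : cut z e != 0 -> inc e z.
  by apply: contraR => /(cut_off R orient) ->.
have incn := cut_neq0 R orient rsym rirr.
have re := edge_adj orient rsym rirr.
apply: (iffP orP) => [[rxy|/eqP<-]|[e /ninc ex /ninc ey]].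
- have [e eP] := edge_exists orient rsym rirr rxy.
  by exists e; apply: incn; rewrite (incE orient); case: eP => [[-> ->]|[-> ->]];
    rewrite eqxx ?orbT.
- by have [e ex _] := inc_neighbour x x; exists e; apply: incn.
move: ex ey; rewrite !(incE orient) => /orP[]/eqP-> /orP[]/eqP->.
- by right.
- by left.
- by left; rewrite rsym.
- by right.
Qed.

(** [image_cut] yields a vertex map [t] with a sign at each vertex. The signs agree along an edge,
    because the cuts of its ends have opposite values there both before and after [phi];
    connectedness then makes the sign global, and it is read off at [x0]. *)
Lemma cycle_isometry_automorphism (x0 : T) : exists (c : R) (t : {perm T}),
  [/\ c * c = 1, graph_automorphism r t,
      forall x, phi (cut x) = c *: cut (t x) &
      forall x y, r x y -> phi (dart x y) = c *: dart (t x) (t y)].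
Proof.
have [t tP] := @fin_all_exists T (fun=> T) (fun v w => exists c : R,
  c * c = 1 /\ phi (cut v) = c *: cut w) image_cut.
have [c cP] := @fin_all_exists T (fun=> R) (fun v c =>
  c * c = 1 /\ phi (cut v) = c *: cut (t v)) tP.
have cc v : c v * c v = 1 by case: (cP v).
have phi_cut v : phi (cut v) = c v *: cut (t v) by case: (cP v).
have c0 v : c v != 0.
  by apply/eqP => c0; have /eqP := cc v; rewrite c0 mul0r eq_sym oner_eq0.
have phi_cutE v e : s e * cut v e = c v * cut (t v) (p e).
  by rewrite -phiE phi_cut ffunE.
have cut_eq0 v e : (cut (t v) (p e) == 0) = (cut v e == 0).
  by rewrite -(inj_eq (mulfI (c0 v))) -phi_cutE mulr0 mulf_eq0 (negPf (s_neq0 e)).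
have tI : injective t.
  move=> v v' tv; have [e ev] := inc_neighbour v v'.
  case/orP => [ev'|/eqP//].
  have := cut_neq0 R orient rsym rirr ev.
  by rewrite -cut_eq0 tv cut_eq0 (cut_off _ orient ev') eqxx.
pose tp := perm tI.
have tadj x y : (r (t x) (t y) || (t x == t y)) = (r x y || (x == y)).
  apply/cut_adjE/cut_adjE => -[e e1 e2]; last first.
    by exists (p e); rewrite cut_eq0.
  have [e' e'E] := signed_perm_onto e; exists e'.
    by rewrite -cut_eq0 -e'E.
  by rewrite -cut_eq0 -e'E.
have tr : graph_automorphism r tp.
  move=> x y; rewrite !permE; have [->|xy] := eqVneq x y; first by rewrite !rirr.
  by have := tadj x y; rewrite (inj_eq tI) (negPf xy) !orbF.
have ends_p e x y : r x y -> edge_ends e = [set x; y] ->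
    edge_ends (p e) = [set t x; t y].
  move=> rxy eE; apply/eqP; rewrite eq_sym eqEcard.
  have incp (z : T) : inc e z -> t z \in edge_ends (p e).
    move=> ez; apply: contraT => /(cut_off R orient)/eqP.
    by rewrite cut_eq0 (negPf (cut_neq0 R orient rsym rirr ez)).
  have xy : x != y by apply: contraTneq rxy => ->; rewrite rirr.
  rewrite subUset !sub1set !incp /inc ?eE ?set21 ?set22 //=.
  rewrite cards2 (inj_eq tI) xy orient cards2.
  by rewrite [tail _ == _]eq_sym head_neq_tail.
have c_adj x y : r x y -> c x = c y.
  move=> rxy; have [e [b [_ eE _]]] := dart_signed_delta R orient rsym rirr rxy.
  have xy : x != y by apply: contraTneq rxy => ->; rewrite rirr.
  have := cut_mul (ends_p _ _ _ rxy eE); rewrite (inj_eq tI) => /(_ xy) tm.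
  have : (s e * cut x e) * (s e * cut y e) = -1.
    by rewrite mulrACA ss mul1r cut_mul.
  rewrite !phi_cutE mulrACA tm mulrN1 => /oppr_inj cxy.
  by rewrite -[c x]mulr1 -(cc y) mulrA cxy mul1r.
have c_const x y : c x = c y.
  (* An auxiliary vertex [u] other than [x] and [y]: its deletion leaves these two connected. *)
  have [u [_ ux uy]] : exists u, [/\ r x u, u != x & u != y] := deg3 x x y.
  apply: (@grad_const (~: [set u; u])).
    by apply: conn3; rewrite setUid inE eq_sym.
  move=> e _; rewrite ffunE (c_adj (tail e) (head e)) ?subrr //.
  exact: (edge_adj orient rsym rirr).
exists (c x0), tp; split=> // [x|x y rxy].
  by rewrite permE phi_cut (c_const x x0).
(* The sign of a dart on its edge is the value there of the cut at its end, so the formula for darts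
   follows from [phi_cutE]. *)
have dart_cut (a b : T) (e : E) (k : R) :
    r a b -> dart a b = k *: delta e -> k * cut b e = 1.
  move=> rab dE.
  rewrite -dot_delta dotC -dotZl -dE (dot_dart_grad orient rsym rirr) //.
  rewrite eqxx; have /negPf-> : a != b by apply: contraTneq rab => ->; rewrite rirr.
  by rewrite subr0.
have sgn2 (b : bool) : (-1) ^+ b * (-1) ^+ b = 1 :> R.
  by case: b; rewrite ?mulrNN mulr1.
rewrite !permE; have [e [b [dE eE _]]] := dart_signed_delta R orient rsym rirr rxy.
have rtxy : r (t x) (t y) by rewrite -[t x]permE -[t y]permE tr.
have [e' [b' [dE' eE' _]]] := dart_signed_delta R orient rsym rirr rtxy.
have e'E : e' = p e by apply: val_inj; rewrite /= eE' (ends_p _ _ _ rxy eE).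
rewrite {e'}e'E in dE' eE'.
have eb := dart_cut _ _ _ _ rxy dE; have eb' := dart_cut _ _ _ _ rtxy dE'.
have phi_delta : phi (delta e) = s e *: delta (p e).
  apply/ffunP => a; have [a' ->] := signed_perm_onto a.
  rewrite phiE !ffunE (inj_eq pI) -[RHS]/(_ * _).
  by case: eqP => [->//|_]; rewrite !mulr0.
rewrite dE dE' linearZ /= phi_delta !scalerA; congr (_ *: _).
have -> : (-1) ^+ b = cut y e.
  by apply: (@mulfI _ ((-1) ^+ b)); rewrite ?signr_eq0 ?sgn2 ?eb.
have -> : (-1) ^+ b' = cut (t y) (p e).
  by apply: (@mulfI _ ((-1) ^+ b')); rewrite ?signr_eq0 ?sgn2 ?eb'.
by rewrite mulrC phi_cutE (c_const x0 y).
Qed.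

End CycleIsometry.

End Whitney.

(** * Invariant projections *)

Section Projections.
Variables (R : realType) (T : finType) (r : rel T).
Variables (tail head : edge r -> T).
Local Notation V := (edge_space R r).
Local Notation cycle := (in_cycle_space tail head).
Local Notation cut := (@cut R T r tail head).
Local Notation grad := (@grad R T r tail head).
Variable P : 'End(V).
Hypothesis PP : forall F : V, cycle (P F) /\ exists f, F = P F + grad f.

Lemma cycle_grad_unique (F G : V) f g : cycle F -> cycle G ->
  F + grad f = G + grad g -> F = G.
Proof.
move=> FZ GZ FG; apply/eqP; rewrite -subr_eq0; apply/eqP/dot_self_eq0.
have FGE : F - G = grad g - grad f.
  by apply/eqP; rewrite subr_eq addrAC [_ + G]addrC -FG addrK.
have FGZ : cycle (F - G).
  by rewrite -scaleN1r; apply: cycle_spaceD => //; apply: cycle_spaceZ.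
by rewrite {2}FGE dotDr dotNr !dot_cycle_grad // subr0.
Qed.

Lemma cycle_projection_id F : cycle F -> P F = F.
Proof.
move=> FZ; have [PZ [f FE]] := PP F.
apply: (@cycle_grad_unique _ _ f (fun=> 0)) => //.
by rewrite -FE; apply/ffunP => e; rewrite !ffunE subrr addr0.
Qed.

Lemma cycle_retraction (Q : 'End(V)) : (forall F, cycle (Q F)) ->
  (forall F, cycle F -> Q F = F) -> projection_onto_cycle_space tail head Q.
Proof.
move=> QZ Qid; split=> F; first exact: Qid.
by split=> [/Qid|[F' <-]]; [exists F|].
Qed.

(** [phi] carries the decomposition of [F] into a cycle and a gradient to that of [phi F]. *)
Lemma cycle_projection_invariant (phi : 'End(V)) :
  (forall F, cycle F -> cycle (phi F)) ->
  (forall f, exists g, phi (grad f) = grad g) ->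
  forall F, P (phi F) = phi (P F).
Proof.
move=> phiZ phiG F; have [PZ [f FE]] := PP F; have [g gE] := phiG f.
have [PphiZ [h hE]] := PP (phi F).
apply: (@cycle_grad_unique _ _ h g) => //; first exact: phiZ.
by rewrite -hE -gE -linearD -FE.
Qed.

End Projections.

Theorem theorem12 (R : realType) (gT : finGroupType) (X : {set gT})
  (nonsolvable : ~~ solvable [set: gT])
  (Xinv : (X^-1)%g = X)
  (Xgen : <<X>>%g = [set: gT])
  (X1 : 1%g \notin X)
  (autX : forall s : {perm gT}, graph_automorphism (cayley X) s ->
     exists h : gT, forall g : gT, s g = (g * h)%g)
  (tail head : edge (cayley X) -> gT)
  (orient : is_orientation tail head) :
  exists P Q : 'End(edge_space R (cayley X)),
    [/\ P <> Q, invariant_projection tail head P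
      & invariant_projection tail head Q].
Proof.
have rsym := cayley_sym Xinv; have rirr := cayley_irr X1.
have deg3 := cayley_degree nonsolvable Xinv Xgen.
have conn3 := cayley_connected nonsolvable Xinv Xgen.
pose r := cayley X.
(* Three distinct neighbours of 1: [s] defines [N], a test cycle passes through 1 by way of [s] and
   [t], and [v] is the source of a test flow into 1. *)
have [s [r1s s1 _]] := deg3 1%g 1%g 1%g.
have [t [r1t ts t1]] := deg3 1%g s 1%g.
have [v [r1v vs vt]] := deg3 1%g s t.
have v1 : v != 1%g by apply: contraTneq r1v => ->; rewrite rirr.
have rs g : r g (s * g)%g by move: r1s; rewrite /r /cayley invg1 mulg1 mulgK.
have [P PP] := cycle_projection R tail head.
pose N0 (F : edge_space R r) : edge_space R r :=
  \sum_g dot F (cut R tail head g) *: dart R tail head g (s * g)%g.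
have N0L : linear N0.
  move=> a F G; rewrite /N0 scaler_sumr -big_split; apply: eq_bigr => g _ /=.
  by rewrite dotDl dotZl scalerDl scalerA.
have [N NE] := exists_linfun N0L.
have NZ F : in_cycle_space tail head F -> N F = 0.
  by rewrite cycle_spaceP NE => FZ; rewrite /N0 big1 // => g _; rewrite FZ scale0r.
have inv (phi : 'End(edge_space R r)) : in_Cyc tail head phi ->
    (forall F, P (phi F) = phi (P F)) /\ (forall F, N (phi F) = phi (N F)).
  case=> iso phiZ; have [p [sg phiS]] := l1_isometry_signed_perm iso.
  split.
    apply: cycle_projection_invariant => //.
      by move=> F FZ; apply/phiZ; exists F.
    exact: signed_perm_grad phiS phiZ.
  have [c [q [cc qaut phi_cut phi_dart]]] :=
    cycle_isometry_automorphism orient rsym rirr conn3 deg3 phiS phiZ 1%g.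
  have [h qE] := autX q qaut.
  (* [q] is a right shift, so it commutes with left multiplication by [s]. Each side acquires one
     factor [c]: from the cut on the left, from the dart on the right. *)
  move=> F; rewrite !NE /N0 linear_sum (reindex_inj (@perm_inj _ q)) /=.
  apply: eq_bigr => g _; rewrite linearZ /= phi_dart //.
  have -> : cut R tail head (q g) = c *: phi (cut R tail head g).
    by rewrite phi_cut scalerA cc scale1r.
  rewrite dotZr (dot_signed_perm phiS) scalerA mulrC.
  by rewrite !qE mulgA.
exists P, (P + (P \o N))%VF; split.
- move=> PQ.
  have PN F : P (N F) = 0.
    apply/eqP; rewrite -(inj_eq (addrI (P F))) addr0.
    by rewrite {3}PQ add_lfunE comp_lfunE.
  (* A unit flow from [v] to 1 leaves only two darts in [N F]. *)
  have [F FE] : exists F : edge_space R r, forall g,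
      dot F (cut R tail head g) = (g == 1%g)%:R - (g == v)%:R.
    have [u [_ u1 uv]] := deg3 1%g 1%g v.
    have vN : v \notin [set u; u] by rewrite setUid inE eq_sym.
    have oneN : 1%g \notin [set u; u] by rewrite setUid inE eq_sym.
    have [F [Fd _]] := flow_within R orient rsym rirr (conn3 _ _ _ _ vN oneN).
    by exists F => g; rewrite Fd ![g == _]eq_sym.
  have NFE : N F = dart R tail head 1%g s - dart R tail head v (s * v)%g.
    rewrite NE /N0 (bigD1 1%g) // (bigD1 v) //= big1 => [|g /andP[g1 gv]].
      rewrite !FE !eqxx eq_sym (negPf v1) mulg1 addr0 sub0r subr0 scale1r.
      by rewrite scaleN1r.
    by rewrite FE (negPf g1) (negPf gv) subrr scale0r.
  have sv : s != v by rewrite eq_sym.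
  have tv : t != v by rewrite eq_sym.
  (* Apart from its two edges at 1, this cycle avoids all edges at 1 and at [v], in particular the
     one from [v] to [s * v]. *)
  have [G [GZ G0]] := cycle_through R orient rsym rirr conn3 r1s r1t sv tv.
  (* As [P (N F) = 0], [N F] is a gradient and must be orthogonal to the cycle, yet their pairing is
     a product of two signs. *)
  have [_ [f NFf]] := PP (N F); rewrite PN add0r in NFf.
  set z := (_ + G) in GZ.
  have := dot_cycle_grad f GZ; rewrite -NFf NFE dotDr dotNr.
  have [e [b [dE eE _]]] := dart_signed_delta R orient rsym rirr r1s.
  have [e' [b' [dE' eE' _]]] := dart_signed_delta R orient rsym rirr (rs v).
  have zE : z e = (-1) ^+ b.
    have et : dart R tail head 1%g t e = 0.
      apply: (dart_off R orient); rewrite eE; apply: contraTneq (set22 1%g t) => <-.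
      by rewrite !inE (negPf t1) (negPf ts).
    rewrite /z ffunE G0 /inc ?eE ?set21 // addr0 ffunE.
    rewrite [(- dart R tail head 1%g t) e]ffunE et subr0.
    by rewrite dE !ffunE eqxx -[LHS]/(_ * 1) mulr1.
  have zE' : z e' = 0.
    have e'v x : x != v -> dart R tail head 1%g x e' = 0.
      move=> xv; apply: (dart_off R orient); rewrite eE'.
      apply: contraTneq (set21 v (s * v)%g) => ->.
      by rewrite !inE (negPf v1) eq_sym.
    rewrite /z ffunE G0 /inc ?eE' ?set21 ?orbT // addr0 ffunE.
    rewrite [(- dart R tail head 1%g t) e']ffunE.
    by rewrite !e'v // subrr.
  rewrite dE dE' !dotZr !dot_delta zE zE' mulr0 subr0 => /eqP.
  by rewrite mulf_eq0 signr_eq0.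
- split; last by move=> phi /inv[].
  by apply: cycle_retraction => F; [case: (PP F)|apply: cycle_projection_id].
split.
  apply: cycle_retraction => F; rewrite add_lfunE comp_lfunE.
    have [PZ _] := PP F; have [PNZ _] := PP (N F); exact: cycle_spaceD.
  by move=> FZ; rewrite NZ // linear0 addr0; apply: cycle_projection_id.
move=> phi /inv[Pphi Nphi] F.
by rewrite !add_lfunE !comp_lfunE Nphi !Pphi linearD.
Qed.
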